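(* Let $X$ be an Archimedean ordered vector space with a generating cone (i.e. $X=X_+-X_+$) and let $Y$ be any ordered vector space. Then every order continuous linear operator $T:X\to Y$ is order bounded.
   Context: All vector spaces are real. An ordered vector space $X$ has positive cone $X_+$ (with $X_+\cap(-X_+)=\{0\}$); order intervals are $[a,b]=\{x: a\le x\le b\}$. $X$ is Archimedean if $nx\le y$ for all $n\in\mathbb{N}$ implies $x\le 0$. The notation $g_\beta\downarrow 0$ means a decreasing net with infimum $0$. A net $(x_\alpha)$ in $X$ o-converges to $x$ if there is a net $g_\beta\downarrow 0$ in $X$ (possibly over a different index set) such that for each $\beta$ there is $\alpha_\beta$ with $-g_\beta\le x_\alpha-x\le g_\beta$ for all $\alpha\ge\alpha_\beta$. A linear operator $T:X\to Y$ is order continuous if $Tx_\alpha$ o-converges to $0$ in $Y$ whenever the net $(x_\alpha)$ o-converges to $0$ in $X$. $T$ is order bounded if for every order interval $[a,b]$ in $X$ the set $T[a,b]$ is contained in an order interval of $Y$. *)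

(* Defs.v *)
From HB Require Import structures.
From mathcomp Require Import all_boot all_order all_algebra.
From mathcomp Require Import boolp classical_sets functions set_interval reals.

Set Implicit Arguments.
Unset Strict Implicit.
Unset Printing Implicit Defensive.

Import Order.TTheory GRing.Theory Num.Theory.
Local Open Scope classical_set_scope.
Local Open Scope ring_scope.

(* A real vector space with a partial order compatible with addition and with
   multiplication by nonnegative scalars; antisymmetry of the order amounts to
   X_+ `&` - X_+ = [set 0]. *)
HB.mixin Record isOrderedVectorSpace (R : realType) V
    of Num.POrderedZmodule V & GRing.Lmodule R V := {
  ovs_lerD2r : forall z x y : V, x <= y -> x + z <= y + z ;
  ovs_lerZ2l : forall (a : R) (x y : V), 0 <= a -> x <= y -> a *: x <= a *: y
}.

#[short(type="orderedVectorSpace")]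
HB.structure Definition OrderedVectorSpace (R : realType) :=
  { V of Num.POrderedZmodule V & GRing.Lmodule R V
       & isOrderedVectorSpace R V }.

Section OrderedVectorSpaces.
Variable R : realType.

Definition positive_cone (X : orderedVectorSpace R) : set X :=
  [set x | 0 <= x].

Definition generating_cone (X : orderedVectorSpace R) : Prop :=
  forall x : X, exists u v : X,
    [/\ positive_cone u, positive_cone v & x = u - v].

(* Including n = 0 is harmless: if x *+ n <= y for all n >= 1, then
   x *+ n <= y - x for all n >= 0. *)
Definition archimedean_ovs (X : orderedVectorSpace R) : Prop :=
  forall x y : X, (forall n : nat, x *+ n <= y) -> x <= 0.

(* A net in X is a function to X from a directed preorder. *)
Definition directed d (I : preorderType d) : Prop :=
  inhabited I /\ forall i j : I, exists k : I, (i <= k)%O /\ (j <= k)%O.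

Definition net_decreases_to0 (X : orderedVectorSpace R)
    d (I : preorderType d) (g : I -> X) : Prop :=
  (forall i j : I, (i <= j)%O -> g j <= g i) /\ infimums (range g) 0.

Definition o_converges (X : orderedVectorSpace R)
    d (I : preorderType d) (x : I -> X) (l : X) : Prop :=
  exists d' (J : preorderType d') (g : J -> X),
    [/\ directed J, net_decreases_to0 g
      & forall j : J, exists i0 : I, forall i : I, (i0 <= i)%O ->
          - g j <= x i - l <= g j].

Definition order_continuous (X Y : orderedVectorSpace R) (T : X -> Y) : Prop :=
  forall d (I : preorderType d) (x : I -> X),
    directed I -> o_converges x 0 -> o_converges (T \o x) 0.

Definition order_bounded (X Y : orderedVectorSpace R) (T : X -> Y) : Prop :=
  forall a b : X, exists c d : Y,
    T @` `[a, b]%classic `<=` `[c, d]%classic.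

End OrderedVectorSpaces.

(* Main.v *)
(** Fix [u >= 0] and let the index set be [nat * [0, u]], preordered by the first
    component only. The net [(n, y) |-> n.+1^-1 *: y] is dominated by
    [n.+1^-1 *: u], which decreases to 0 because [X] is Archimedean. Order
    continuity then gives one [g] in [Y] and one [n] with
    [- g <= n.+1^-1 *: T y <= g]; as all the [(n, y)] are equivalent indices,
    this holds for every [y] in [0, u] simultaneously. *)
Require Import Defs.
From HB Require Import structures.
From mathcomp Require Import all_boot all_order all_algebra.
From mathcomp Require Import boolp classical_sets functions set_interval reals.

Set Implicit Arguments.
Unset Strict Implicit.
Unset Printing Implicit Defensive.

Import Order.TTheory GRing.Theory Num.Theory.
Local Open Scope ring_scope.

(** A separate alias, so that the preorder attached to it stays apart from any order on the plain
    product. *)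
Definition nat_prefixed (A : Type) : Type := (nat * A)%type.

HB.instance Definition _ (A : choiceType) :=
  Choice.copy (nat_prefixed A) (nat * A)%type.

Section NatPrefixedPreorder.
Variable A : choiceType.
Implicit Types i j k : nat_prefixed A.

Definition le_prefix i j := (i.1 <= j.1)%N.
Definition lt_prefix i j := (i.1 < j.1)%N.

Lemma lt_prefix_def i j : lt_prefix i j = le_prefix i j && ~~ le_prefix j i.
Proof. by rewrite /lt_prefix /le_prefix -ltnNge andbC; case: ltngtP. Qed.

Lemma le_prefix_refl : reflexive le_prefix.
Proof. by move=> i; exact: leqnn. Qed.

Lemma le_prefix_trans : transitive le_prefix.
Proof. by move=> j i k; exact: leq_trans. Qed.

Fact prefix_display : Order.disp_t. Proof. exact: Order.Disp tt tt. Qed.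

HB.instance Definition _ :=
  Order.isPreorder.Build prefix_display (nat_prefixed A)
    lt_prefix_def le_prefix_refl le_prefix_trans.

Lemma directed_nat_prefixed : inhabited A -> directed (nat_prefixed A).
Proof.
move=> [a]; split=> [|i j]; first by split; exact: (0, a).
exists (maxn i.1 j.1, a).
by split; [exact: leq_maxl|exact: leq_maxr].
Qed.

End NatPrefixedPreorder.

Section OrderedVectorSpaceTheory.
Variables (R : realType) (X : orderedVectorSpace R).
Implicit Types x y z u : X.

Lemma ovs_lerN2 x y : x <= y -> - y <= - x.
Proof.
by move=> /(ovs_lerD2r (- x - y) _ _); rewrite addrA subrr add0r addrCA subrr addr0.
Qed.

Lemma ovs_lerZ2r (a b : R) u : 0 <= u -> a <= b -> a *: u <= b *: u.
Proof.
move=> u0 ab; have ba0 : 0 <= b - a by rewrite subr_ge0.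
have := ovs_lerD2r (a *: u) _ _ (ovs_lerZ2l _ _ _ ba0 u0).
by rewrite scaler0 add0r -scalerDl subrK.
Qed.

Lemma ovs_ler_invZl (a : R) x y : 0 < a -> a^-1 *: x <= y -> x <= a *: y.
Proof.
move=> a0 /(ovs_lerZ2l _ _ _ (ltW a0)).
by rewrite scalerA divff ?gt_eqF// scale1r.
Qed.

Lemma ovs_ler_invZr (a : R) x y : 0 < a -> x <= a^-1 *: y -> a *: x <= y.
Proof.
move=> a0 /(ovs_lerZ2l _ _ _ (ltW a0)).
by rewrite scalerA divff ?gt_eqF// scale1r.
Qed.

(** Multiplying out, a lower bound [z] of the range satisfies [z *+ n.+1 <= u] for every [n], so the
    Archimedean property forces [z <= 0]. *)
Lemma archimedean_invn_decreases_to0 u : archimedean_ovs X -> 0 <= u ->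
  net_decreases_to0 (fun n : nat => n.+1%:R^-1 *: u : X).
Proof.
move=> arch u0; split=> [m n mn|].
  apply: ovs_lerZ2r => //.
  by rewrite lef_pV2 ?posrE ?ltr0n// ler_nat ltnS.
split=> [_ [n _ <-]|z zlb].
  by rewrite -[X in X <= _](scale0r u); apply: ovs_lerZ2r; rewrite ?invr_ge0.
(* The multiple [n = 0] corresponds to no term of the net; there the claim is just [0 <= u]. *)
apply: (arch _ u) => -[|n]; first by rewrite mulr0n.
rewrite -scaler_nat; apply: ovs_ler_invZr; first by rewrite ltr0n.
by apply: zlb; exists n.
Qed.

End OrderedVectorSpaceTheory.

Lemma order_continuous_bounded_itv0 (R : realType) (X Y : orderedVectorSpace R)
    (T : {linear X -> Y}) (u : X) :
    archimedean_ovs X -> order_continuous T -> 0 <= u ->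
  exists c : Y, forall y, 0 <= y <= u -> - c <= T y <= c.
Proof.
move=> arch Tcont u0.
pose A : choiceType := {y : X | 0 <= y <= u}.
have u0A : inhabited A by split; exists 0; rewrite lexx.
pose x (i : nat_prefixed A) : X := i.1.+1%:R^-1 *: val i.2.
have xcvg : o_converges x 0.
  have [gdec ginf] := archimedean_invn_decreases_to0 arch u0.
  exists _, nat, (fun n : nat => n.+1%:R^-1 *: u); split=> //.
    split=> [|m n]; first by split; exact: 0%N.
    by exists (maxn m n); split; [exact: leq_maxl|exact: leq_maxr].
  (* The second component of the threshold index is arbitrary, since only the first one is
     compared. *)
  have [a] := u0A; move=> n; exists (n, a) => -[m [y yP]] nm.
  have /andP[y0 yu] := yP.
  have V0 : 0 <= m.+1%:R^-1 :> R by rewrite invr_ge0.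
  have Vu : m.+1%:R^-1 *: u <= n.+1%:R^-1 *: u by exact: gdec.
  have Vy0 : 0 <= m.+1%:R^-1 *: y by rewrite -(scaler0 _ m.+1%:R^-1) ovs_lerZ2l.
  have Vyu : m.+1%:R^-1 *: y <= n.+1%:R^-1 *: u.
    exact: le_trans (ovs_lerZ2l _ _ _ V0 yu) Vu.
  rewrite /x /= subr0 Vyu andbT (le_trans _ Vy0)//.
  by rewrite -[leRHS]oppr0 ovs_lerN2// (le_trans Vy0).
(* A single [j] suffices: that [g] decreases to 0 is irrelevant for boundedness. *)
have [d [J [g [[[j] _] _ /(_ j)[[n a] Tx]]]]] :=
  Tcont _ _ x (directed_nat_prefixed u0A) xcvg.
(* The factor [n.+1%:R] undoes the scaling in the net. It is the same for all [y], because [(n, y)]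
   lies above the threshold [(n, a)] whatever [y] is. *)
exists (n.+1%:R *: g j) => y yu.
have /andP[] := Tx (n, exist _ y yu) (leqnn n).
rewrite /x /= subr0 linearZ /= => lo up.
have n0 : 0 < n.+1%:R :> R by rewrite ltr0n.
apply/andP; split; last exact: ovs_ler_invZl.
have := ovs_lerZ2l _ _ _ (ltW n0) lo.
by rewrite scalerN scalerA divff ?gt_eqF// scale1r.
Qed.

Theorem corollary2p2 (R : realType) (X Y : orderedVectorSpace R)
  (X_archimedean : archimedean_ovs X) (X_generating : generating_cone X)
  (T : {linear X -> Y}) :
  order_continuous T -> order_bounded T.
Proof.
move=> Tcont a b.
(* If [a <= b] fails, the interval is empty and any bounds will do. *)
have [ab|nab] := boolP (a <= b); last first.
  exists 0, 0 => _ [y + <-]; rewrite set_itvcc /= => /andP[ay yb].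
  by rewrite (le_trans ay yb) in nab.
(* Translation by [a] reduces to the interval from 0 to [b - a]; by linearity the bounds in [Y]
   shift by [T a]. *)
have ba0 : 0 <= b - a by rewrite -(subrr a) ovs_lerD2r.
have [c cP] := order_continuous_bounded_itv0 X_archimedean Tcont ba0.
exists (- c + T a), (c + T a) => _ [y + <-].
rewrite !set_itvcc /= => /andP[ay yb].
have /cP/andP[lo up] : 0 <= y - a <= b - a.
  by rewrite -{1}(subrr a) !ovs_lerD2r.
have -> : T y = T (y - a) + T a by rewrite -linearD subrK.
by rewrite !ovs_lerD2r.
Qed.
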